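(* Let $X$ be a nonempty set, $\Theta$ be a nonempty open interval of $\mathbb{R}$, and $\psi\in\Psi[T_1](X,\Theta)$, with $\vartheta_1:=\vartheta_{1,\psi}$. For $x,y\in X$ with $\vartheta_1(x)<\vartheta_1(y)$ consider the function $$R_{x,y}:(\vartheta_1(x),\vartheta_1(y))\to\mathbb{R},\qquad R_{x,y}(t):=-\frac{\psi(x,t)}{\psi(y,t)}.$$ Then the following assertions hold. (i) If $\psi\in\Psi[T_2^{(\lambda_1,\lambda_2)}](X,\Theta)$ for some $(\lambda_1,\lambda_2)\in(0,\infty)^2$, then, for each $x,y\in X$ with $\vartheta_1(x)<\vartheta_1(y)$, the numbers $\frac{\lambda_1}{\lambda_2}$ and $\frac{\lambda_2}{\lambda_1}$ are levels of increase for $R_{x,y}$. (ii) If $\psi\in\Psi[T_n^{(\lambda_1,\ldots,\lambda_n)}](X,\Theta)$ for some $n\in\mathbb{N}\setminus\{1\}$ and $(\lambda_1,\ldots,\lambda_n)\in(0,\infty)^n$, then, for each $x,y\in X$ with $\vartheta_1(x)<\vartheta_1(y)$, the numbers $\frac{\lambda_1+\cdots+\lambda_k}{\lambda_{k+1}+\cdots+\lambda_n}$ and $\frac{\lambda_{k+1}+\cdots+\lambda_n}{\lambda_1+\cdots+\lambda_k}$, $k\in\{1,\ldots,n-1\}$, are levels of increase for $R_{x,y}$. (iii) If $\psi\in\Psi[T_n](X,\Theta)$ for some $n\in\mathbb{N}\setminus\{1\}$, then, for each $x,y\in X$ with $\vartheta_1(x)<\vartheta_1(y)$, the elements of the set $\{\frac{k}{n-k}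 : k\in\{1,\dots,n-1\}\}$ are levels of increase for $R_{x,y}$. (iv) If $\psi\in\Psi[T_n](X,\Theta)$ for infinitely many $n\in\mathbb{N}$, then, for each $x,y\in X$ with $\vartheta_1(x)<\vartheta_1(y)$, the function $R_{x,y}$ is increasing. In addition, if for each $m\in\mathbb{N}$ there exists $n\in\mathbb{N}$ such that $m$ divides $n$ and $\psi\in\Psi[T_n](X,\Theta)$, then, for each $x,y\in X$ with $\vartheta_1(x)<\vartheta_1(y)$, every positive rational number is a level of increase for $R_{x,y}$. (v) If $\psi\in\Psi[T_2^{\boldsymbol{\lambda}}](X,\Theta)$ for each $\boldsymbol{\lambda}\in\Lambda_2$, then, for each $x,y\in X$ with $\vartheta_1(x)<\vartheta_1(y)$, the function $R_{x,y}$ is strictly increasing. (vi) If $\psi\in\Psi[Z_1](X,\Theta)$ and, for each $x,y\in X$ with $\vartheta_1(x)<\vartheta_1(y)$, the function $R_{x,y}$ is strictly increasing, then $\psi\in\Psi[T_n^{\boldsymbol{\lambda}}](X,\Theta)$ for each $n\in\mathbb{N}$ and $\boldsymbol{\lambda}\in\Lambda_n$.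
   Context: $\mathbb{N}$ is the set of positive integers; $\Lambda_n:=[0,\infty)^n\setminus\{(0,\ldots,0)\}$. ''Increasing'' means nondecreasing in the weak sense. Point of sign change: for a nonempty open interval $\Theta\subseteq\mathbb{R}$ and $f:\Theta\to\mathbb{R}$, an element $\vartheta\in\Theta$ is a point of sign change (of decreasing type) for $f$ if $f(t)>0$ for all $t\in\Theta$ with $t<\vartheta$ and $f(t)<0$ for all $t\in\Theta$ with $t>\vartheta$. (There is at most one such $\vartheta$; nothing is required of $f(\vartheta)$.) $\Psi(X,\Theta)$ is the class of functions $\psi:X\times\Theta\to\mathbb{R}$ such that for each $x\in X$ there exist $t_+,t_-\in\Theta$ with $t_+<t_-$ and $\psi(x,t_+)>0>\psi(x,t_-)$. For $n\in\mathbb{N}$ and $\boldsymbol{\lambda}=(\lambda_1,\ldots,\lambda_n)\in\Lambda_n$, a function $\psi\in\Psi(X,\Theta)$ has property $[T_n^{\boldsymbol{\lambda}}]$ if for every $(x_1,\ldots,x_n)\in X^n$ the function $\Theta\ni t\mapsto\sum_{i=1}^n\lambda_i\psi(x_i,t)$ has a point of sign change, denoted $\vartheta_{n,\psi}^{\boldsymbol{\lambda}}(x_1,\ldots,x_n)$. Property $[T_n]$ is property $[T_n^{\boldsymbol{\lambda}}]$ with $\boldsymbol{\lambda}=(1,\ldots,1)$, and then the point of sign change is denoted $\vartheta_{n,\psi}(x_1,\ldots,x_n)$ or $\vartheta_n(x_1,\ldots,x_n)$. Property $[Z_n]$ means property $[T_n]$ together with $\sum_{i=1}^n\psi(x_i,\vartheta_{n,\psi}(x_1,\ldots,x_n))=0$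 for all $(x_1,\ldots,x_n)\in X^n$. $\Psi[P](X,\Theta)$ denotes the set of $\psi\in\Psi(X,\Theta)$ having property $[P]$. Note that for $\psi\in\Psi[T_1](X,\Theta)$ and $t\in(\vartheta_1(x),\vartheta_1(y))$ one has $\psi(y,t)>0$, so the quotient is well-defined. Level of increase: for a nonempty open interval $I$ and $f:I\to\mathbb{R}$, a number $c\in\mathbb{R}$ is a level of increase for $f$ if $u,v\in I$ and $f(v)\leq c\leq f(u)$ imply $v\leq u$. *)

(* Defs.v *)
From HB Require Import structures.
From mathcomp Require Import all_boot all_order all_algebra.
From mathcomp Require Import all_classical all_reals all_analysis.

Set Implicit Arguments.
Unset Strict Implicit.
Unset Printing Implicit Defensive.

Import Order.TTheory GRing.Theory Num.Theory.
Import numFieldNormedType.Exports.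

Local Open Scope classical_set_scope.
Local Open Scope ring_scope.

(* Functions on a subset of the line are represented by total functions
   [R -> R]; every definition below only inspects their values on that
   subset. *)

Definition is_sign_change (R : realType) (Theta : set R) (f : R -> R) (v : R)
    : Prop :=
  [/\ Theta v,
      forall t, Theta t -> t < v -> 0 < f t
    & forall t, Theta t -> v < t -> f t < 0].

(* On a nonempty open interval there is at most one such point; the default
   value 0 is returned only when there is none. *)
Definition sign_change_point (R : realType) (Theta : set R) (f : R -> R) : R :=
  xget 0 [set v | is_sign_change Theta f v].

Definition Lambda (R : realType) (n : nat) : set (n.-tuple R) :=
  [set l | (forall i, 0 <= tnth l i) /\ (exists i, tnth l i != 0)].

Definition weighted_sum (R : realType) (X : Type) (psi : X -> R -> R) (n : nat)
    (l : n.-tuple R) (x : n.-tuple X) (t : R) : R :=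
  \sum_(i < n) tnth l i * psi (tnth x i) t.

Definition ones (R : realType) (n : nat) : n.-tuple R := [tuple 1 | i < n].

Definition vartheta (R : realType) (X : Type) (Theta : set R)
    (psi : X -> R -> R) (n : nat) (l : n.-tuple R) (x : n.-tuple X) : R :=
  sign_change_point Theta (weighted_sum psi l x).

Definition vartheta1 (R : realType) (X : Type) (Theta : set R)
    (psi : X -> R -> R) (x : X) : R :=
  vartheta Theta psi (ones R 1) [tuple x].

Definition Psi (R : realType) (X : Type) (Theta : set R) : set (X -> R -> R) :=
  [set psi | forall x, exists tp tm,
     [/\ Theta tp, Theta tm, tp < tm, 0 < psi x tp & psi x tm < 0]].

Definition Psi_Tw (R : realType) (X : Type) (Theta : set R) (n : nat)
    (l : n.-tuple R) : set (X -> R -> R) :=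
  [set psi | Psi Theta psi /\
     forall x : n.-tuple X, exists v,
       is_sign_change Theta (weighted_sum psi l x) v].

Definition Psi_T (R : realType) (X : Type) (Theta : set R) (n : nat)
    : set (X -> R -> R) :=
  Psi_Tw Theta (ones R n).

Definition Psi_Z (R : realType) (X : Type) (Theta : set R) (n : nat)
    : set (X -> R -> R) :=
  [set psi | Psi_T Theta n psi /\
     forall x : n.-tuple X,
       \sum_(i < n) psi (tnth x i) (vartheta Theta psi (ones R n) x) = 0].

Definition level_of_increase (R : realType) (I : set R) (f : R -> R) (c : R)
    : Prop :=
  forall u v, I u -> I v -> f v <= c -> c <= f u -> v <= u.

Definition increasing_on (R : realType) (I : set R) (f : R -> R) : Prop :=
  forall s t, I s -> I t -> s <= t -> f s <= f t.

Definition strictly_increasing_on (R : realType) (I : set R) (f : R -> R)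
    : Prop :=
  forall s t, I s -> I t -> s < t -> f s < f t.

Definition quot (R : realType) (X : Type) (psi : X -> R -> R) (x y : X) (t : R)
    : R :=
  - (psi x t / psi y t).

Definition quot_dom (R : realType) (X : Type) (Theta : set R)
    (psi : X -> R -> R) (x y : X) : set R :=
  [set t | vartheta1 Theta psi x < t < vartheta1 Theta psi y].

(* Main.v *)
Require Import Defs.
From mathcomp Require Import all_boot all_order all_algebra.
From mathcomp Require Import all_classical all_reals all_analysis.
From mathcomp Require Import lra.
Import Order.TTheory GRing.Theory Num.Theory.
Import numFieldNormedType.Exports.
Local Open Scope classical_set_scope.
Local Open Scope ring_scope.
Set Implicit Arguments.
Unset Strict Implicit.
Unset Printing Implicit Defensive.

(** Let [x] and [y] have their sign changes at [theta x < theta y].  Between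
    these points [psi x] is negative and [psi y] positive, so for [a > 0] the
    sum [a * psi x + b * psi y] is nonnegative exactly where the quotient
    [- psi x / psi y] is at most [b / a], and nonpositive exactly where the
    quotient is at least [b / a].  A point of sign change of the sum therefore
    makes [b / a] a level of increase ([level_of_sign_change]).  Samples that
    consist of copies of [x] and [y] turn [n] weights into two
    ([blocks_levels]).  If a function takes a larger value at [s] than at
    [t > s], no number between these values is a level of increase; hence
    monotonicity follows once the levels are dense, and it is strict once all
    positive numbers are levels.  For equal weights the levels [k / (n - k)]
    become dense as [n] grows ([odds_between]).

    For the converse, fix [s < t] and record each function [psi (x i)] by the
    plane vector [(psi (x i) s, psi (x i) t)].  The weighted sum changes sign
    properly when no nontrivial nonnegative combination of these vectors lies in
    the quadrant of the [(p, q)] with [p <= 0 <= q].  Each single vector avoids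
    this quadrant because each [psi (x i)] changes sign and vanishes there;
    strict monotonicity of the quotients says the same for pairs of vectors; and
    in the plane the pairwise condition is enough, because the line spanned by
    the steepest vector with [p > 0], or the horizontal axis when none of these
    has positive slope, separates all the combinations from the quadrant
    ([sum_lt0_of_slopes]).  Completeness of the line then yields the point of
    sign change ([crosses_down_sign_change]). *)

(** * Points of sign change *)

Lemma is_sign_change_ext (R : realType) (Theta : set R) (f g : R -> R) (v : R) :
  f =1 g -> is_sign_change Theta f v -> is_sign_change Theta g v.
Proof.
move=> fg [Tv fpos fneg]; split=> // t Tt tv; rewrite -fg.
  exact: fpos.
exact: fneg.
Qed.

(** A sign change expressed without naming its location, by pairs of parameters
    only: in this form it can be checked for a sum of functions whose own sign
    changes lie at different places. *)
Definition crosses_down (R : realType) (Theta : set R) (f : R -> R) : Prop :=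
  forall s t, Theta s -> Theta t -> s < t -> f s <= 0 -> f t < 0.

Lemma sign_change_crosses_down (R : realType) (Theta : set R) (f : R -> R)
    (v : R) :
  is_sign_change Theta f v -> f v = 0 -> crosses_down Theta f.
Proof.
move=> [Tv fpos fneg] fv0 s t Ts Tt st fs0; apply: fneg => //.
apply: le_lt_trans st; rewrite leNgt; apply/negP => /(fpos s Ts).
by rewrite ltNge fs0.
Qed.

Lemma crosses_down_gt0 (R : realType) (Theta : set R) (f : R -> R) (s t : R) :
  crosses_down Theta f -> Theta s -> Theta t -> s <= t -> 0 < f t -> 0 < f s.
Proof.
move=> fcd Ts Tt; rewrite le_eqVlt => /predU1P[->//|st] ft0.
by rewrite ltNge; apply/negP => /(fcd s t Ts Tt st); rewrite ltNge (ltW ft0).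
Qed.

Lemma crosses_down_lt0 (R : realType) (Theta : set R) (f : R -> R) (s t : R) :
  crosses_down Theta f -> Theta s -> Theta t -> s <= t -> f s < 0 -> f t < 0.
Proof.
move=> fcd Ts Tt; rewrite le_eqVlt => /predU1P[->//|st] fs0.
exact: (fcd s t Ts Tt st (ltW fs0)).
Qed.

(** Completeness of the line is what makes the sign change happen at a point:
    the supremum of the points of positivity separates the signs, and it lies
    in [Theta] because it is squeezed between [p] and [m]. *)
Lemma crosses_down_sign_change (R : realType) (Theta : set R) (f : R -> R)
    (p m : R) :
  is_interval Theta -> crosses_down Theta f ->
  Theta p -> Theta m -> 0 < f p -> f m < 0 ->
  exists v, is_sign_change Theta f v.
Proof.
move=> Titv fcd Tp Tm fp fm.
pose A := [set t | Theta t /\ 0 < f t].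
have Am : ubound A m.
  move=> t [Tt ft]; rewrite leNgt; apply/negP => mt.
  by have := fcd _ _ Tm Tt mt (ltW fm); rewrite ltNge (ltW ft).
have Asup : has_sup A by split; [exists p | exists m].
have pv : p <= sup A by apply: sup_upper_bound.
have vm : sup A <= m by apply: ge_sup => //; exists p.
have Tv : Theta (sup A) by apply: (Titv p m) => //; rewrite pv vm.
exists (sup A); split=> // t Tt tv.
- have [u [Tu fu] tu] := sup_gt (ex_intro _ p (conj Tp fp)) tv.
  exact: (crosses_down_gt0 fcd Tt Tu (ltW tu) fu).
- (* [f t <= 0] is clear; strictness needs a further point before [t]. *)
  have [vw wt] := midf_lt tv; set w := (sup A + t) / 2%:R in vw wt.
  have Tw : Theta w by apply: (Titv (sup A) t) => //; rewrite !ltW.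
  apply: (fcd w t Tw Tt wt); rewrite leNgt; apply/negP => fw.
  have : w <= sup A by apply: sup_upper_bound.
  by rewrite leNgt vw.
Qed.

Lemma vartheta1P (R : realType) (X : Type) (Theta : set R) (psi : X -> R -> R) :
  Psi_T Theta 1 psi ->
  forall x, is_sign_change Theta (psi x) (vartheta1 Theta psi x).
Proof.
move=> [_ T1] x.
apply: (@is_sign_change_ext _ _ (weighted_sum psi (ones R 1) [tuple x])).
  by move=> t; rewrite /weighted_sum big_ord1 tnth_mktuple mul1r.
exact: (@xgetPex _ 0 [set v | is_sign_change Theta _ v] (T1 _)).
Qed.

(** * Levels of increase of the quotient *)

Lemma quot_dom_signs (R : realType) (X : Type) (Theta : set R)
    (psi : X -> R -> R) (x y : X) (t : R) :
  is_interval Theta -> Psi_T Theta 1 psi -> quot_dom Theta psi x y t ->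
  [/\ Theta t, psi x t < 0 & 0 < psi y t].
Proof.
move=> Titv T1 /andP[xt ty].
have [Tx _ xneg] := vartheta1P T1 x; have [Ty ypos _] := vartheta1P T1 y.
have Tt : Theta t by apply: (Titv _ _ Tx Ty); rewrite !ltW.
by split=> //; [apply: xneg|apply: ypos].
Qed.

Lemma quot_gt0 (R : realType) (X : Type) (Theta : set R)
    (psi : X -> R -> R) (x y : X) (t : R) :
  is_interval Theta -> Psi_T Theta 1 psi -> quot_dom Theta psi x y t ->
  0 < quot psi x y t.
Proof.
move=> Titv T1 /(quot_dom_signs Titv T1)[_ xt yt].
by rewrite /quot -mulNr divr_gt0 // oppr_gt0.
Qed.

(** Where [psi y] is positive, comparing the quotient with [b / a] amounts to
    reading off the sign of [a * psi x + b * psi y]. *)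
Lemma level_of_sign_change (R : realType) (X : Type) (Theta : set R)
    (psi : X -> R -> R) (x y : X) (a b w : R) :
  is_interval Theta -> Psi_T Theta 1 psi -> 0 < a ->
  is_sign_change Theta (fun t => a * psi x t + b * psi y t) w ->
  level_of_increase (quot_dom Theta psi x y) (quot psi x y) (b / a).
Proof.
move=> Titv T1 a0 [Tw wpos wneg] u v Iu Iv.
have [Tu _ yu] := quot_dom_signs Titv T1 Iu.
have [Tv _ yv] := quot_dom_signs Titv T1 Iv.
rewrite /quot -!mulNr ler_pdivrMr // ler_pdivlMr // mulrAC ler_pdivlMr //.
rewrite mulrAC ler_pdivrMr // => vle ule; apply: (@le_trans _ _ w).
- by rewrite leNgt; apply/negP => /(wneg v Tv); lra.
- by rewrite leNgt; apply/negP => /(wpos u Tu); lra.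
Qed.

Lemma pair_levels (R : realType) (X : Type) (Theta : set R)
    (psi : X -> R -> R) (x y : X) (a b : R) :
  is_interval Theta -> Psi_T Theta 1 psi -> Psi_Tw Theta [tuple a; b] psi ->
  (0 < b ->
    level_of_increase (quot_dom Theta psi x y) (quot psi x y) (a / b)) /\
  (0 < a ->
    level_of_increase (quot_dom Theta psi x y) (quot psi x y) (b / a)).
Proof.
move=> Titv T1 [_ Tab]; split=> [b0|a0].
- have [v hv] := Tab [tuple y; x]; apply: (level_of_sign_change Titv T1 b0).
  apply: is_sign_change_ext hv => t.
  by rewrite /weighted_sum big_ord_recl big_ord1 /= addrC.
- have [v hv] := Tab [tuple x; y]; apply: (level_of_sign_change Titv T1 a0).
  apply: is_sign_change_ext hv => t.
  by rewrite /weighted_sum big_ord_recl big_ord1.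
Qed.

Lemma weighted_sum_blocks (R : realType) (X : Type) (psi : X -> R -> R)
    (n k : nat) (l : n.-tuple R) (x y : X) (t : R) :
  weighted_sum psi l [tuple if (i < k)%N then x else y | i < n] t =
  (\sum_(i < n | (i < k)%N) tnth l i) * psi x t +
  (\sum_(i < n | (k <= i)%N) tnth l i) * psi y t.
Proof.
rewrite /weighted_sum (bigID (fun i : 'I_n => (i < k)%N)) /= !mulr_suml.
congr (_ + _).
- by apply: eq_bigr => i ik; rewrite tnth_mktuple ik.
- apply: eq_big => i; first by rewrite -leqNgt.
  by rewrite tnth_mktuple => /negPf->.
Qed.

(** The sample of [k] copies of one point followed by [n - k] copies of the
    other reduces [n] weights to two; which point comes first decides which of
    the two quotients appears. *)
Lemma blocks_levels (R : realType) (X : Type) (Theta : set R)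
    (psi : X -> R -> R) (n k : nat) (l : n.-tuple R) (x y : X) :
  is_interval Theta -> Psi_T Theta 1 psi ->
  (forall i, 0 < tnth l i) -> Psi_Tw Theta l psi -> (0 < k < n)%N ->
  level_of_increase (quot_dom Theta psi x y) (quot psi x y)
    ((\sum_(i < n | (i < k)%N) tnth l i) /
     (\sum_(i < n | (k <= i)%N) tnth l i)) /\
  level_of_increase (quot_dom Theta psi x y) (quot psi x y)
    ((\sum_(i < n | (k <= i)%N) tnth l i) /
     (\sum_(i < n | (i < k)%N) tnth l i)).
Proof.
move=> Titv T1 l0 [_ Tw] /andP[k0 kn].
have n0 : (0 < n)%N := ltn_trans k0 kn.
have part_gt0 (P : pred 'I_n) i : P i -> 0 < \sum_(i < n | P i) tnth l i.
  move=> Pi; rewrite (bigD1 i) //= ltr_pwDl // sumr_ge0 // => j _.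
  exact: ltW.
split.
- have [v] := Tw [tuple if (i < k)%N then y else x | i < n].
  move=> /(is_sign_change_ext (weighted_sum_blocks psi k l y x)) hv.
  apply: (level_of_sign_change Titv T1 (part_gt0 _ (Ordinal kn) (leqnn k))).
  by apply: is_sign_change_ext hv => t; rewrite addrC.
- have [v] := Tw [tuple if (i < k)%N then x else y | i < n].
  move=> /(is_sign_change_ext (weighted_sum_blocks psi k l x y)) hv.
  exact: (level_of_sign_change Titv T1 (part_gt0 _ (Ordinal n0) k0) hv).
Qed.

Lemma equal_weights_levels (R : realType) (X : Type) (Theta : set R)
    (psi : X -> R -> R) (n k : nat) (x y : X) :
  is_interval Theta -> Psi_T Theta 1 psi ->
  Psi_T Theta n psi -> (0 < k < n)%N ->
  level_of_increase (quot_dom Theta psi x y) (quot psi x y)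
    (k%:R / (n - k)%:R).
Proof.
move=> Titv T1 Tn /[dup] kn /andP[_ /ltnW kn'].
have ones_gt0 i : 0 < tnth (ones R n) i by rewrite tnth_mktuple.
have [+ _] := blocks_levels x y Titv T1 ones_gt0 Tn kn.
have onesE (P : pred 'I_n) : \sum_(i < n | P i) tnth (ones R n) i = #|P|%:R.
  rewrite (eq_bigr (fun=> 1)) => [|i _]; last by rewrite tnth_mktuple.
  by rewrite sumr_const.
have cardk : #|[pred i : 'I_n | (i < k)%N]| = k.
  rewrite -sum1_card (eq_bigl (fun i : 'I_n => (i < k)%N)) //.
  by rewrite (big_ord_narrow kn') sum1_card card_ord.
have cardnk : #|[pred i : 'I_n | (k <= i)%N]| = (n - k)%N.
  have := cardC [pred i : 'I_n | (i < k)%N].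
  rewrite cardk card_ord => nE.
  rewrite -[X in (X - _)%N]nE addKn.
  by apply: eq_card => i; rewrite !inE -leqNgt.
rewrite (onesE (fun i => (i < k)%N)) (onesE (fun i => (k <= i)%N)).
by rewrite cardk cardnk.
Qed.

(** * Monotonicity from levels *)

(** A descent of [f] from [f s] to [f t] would jump over a level. *)
Lemma increasing_of_dense_levels (R : realType) (I : set R) (f : R -> R) :
  (forall t, I t -> 0 < f t) ->
  (forall a b, 0 < a -> a < b ->
     exists2 c, a < c < b & level_of_increase I f c) ->
  increasing_on I f.
Proof.
move=> f0 dense s t Is It; rewrite le_eqVlt => /predU1P[->//|st].
rewrite leNgt; apply/negP => /(dense _ _ (f0 t It))[c /andP[tc cs] lc].
by have := lc s t Is It (ltW tc) (ltW cs); rewrite leNgt st.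
Qed.

Lemma strictly_increasing_of_levels (R : realType) (I : set R) (f : R -> R) :
  (forall t, I t -> 0 < f t) ->
  (forall c, 0 < c -> level_of_increase I f c) ->
  strictly_increasing_on I f.
Proof.
move=> f0 lev s t Is It st; rewrite ltNge; apply/negP => ts.
by have := lev (f s) (f0 s Is) s t Is It ts (lexx _); rewrite leNgt st.
Qed.

(** The map [c |-> c / (1 + c)] carries [k / (n - k)] to [k / n], and
    the grid of multiples of [1 / n] meets the image of [(a, b)] as soon as
    [1 / n] is smaller than the length of that image. *)
Lemma odds_between (R : realType) (a b : R) :
  0 < a -> a < b ->
  exists N, forall n, (N < n)%N ->
    exists2 k, (0 < k < n)%N & a < k%:R / (n - k)%:R < b.
Proof.
move=> a0 ab; have b0 := lt_trans a0 ab.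
have a10 : 0 < 1 + a by rewrite addr_gt0.
have b10 : 0 < 1 + b by rewrite addr_gt0.
pose p := a / (1 + a); pose q := b / (1 + b).
have pq : 0 < q - p.
  rewrite subr_gt0 /p /q ltr_pdivrMr // mulrAC ltr_pdivlMr //; lra.
have p0 : 0 < p by rewrite divr_gt0.
exists (Num.truncn (q - p)^-1) => n Nn.
have n0 : 0 < n%:R :> R by rewrite ltr0n (leq_ltn_trans _ Nn).
have mesh : 1 < n%:R * (q - p).
  rewrite -ltr_pdivrMr // div1r (lt_le_trans (truncnS_gt _)) // ler_nat.
  exact: Nn.
have /andP[kle klt] := truncn_itv (ltW (mulr_gt0 n0 p0)).
(* The first grid point to the right of [p]; it is positive since it is a
   successor. *)
set k := (Num.truncn (n%:R * p)).+1 in klt *.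
have kq : k%:R < n%:R * q by rewrite /k -natr1; lra.
have q1 : q < 1 by rewrite /q ltr_pdivrMr // mul1r ltrDr.
have kn : (k < n)%N.
  rewrite -(ltr_nat R); apply: lt_le_trans kq _; rewrite -[leRHS]mulr1.
  by rewrite ler_wpM2l // ltW.
exists k; first by rewrite kn.
have nk0 : 0 < (n - k)%:R :> R by rewrite ltr0n subn_gt0.
have kp : n%:R * a < k%:R * (1 + a).
  by rewrite -ltr_pdivrMr // -mulrA.
have {}kq : k%:R * (1 + b) < n%:R * b.
  by rewrite -ltr_pdivlMr // -mulrA.
rewrite ltr_pdivlMr // ltr_pdivrMr // natrB; last exact: ltnW.
by apply/andP; split; lra.
Qed.

Lemma ratr_pos_frac (R : realType) (q : rat) : 0 < q ->
  exists a b : nat, [/\ (0 < a)%N, (0 < b)%N & ratr q = a%:R / b%:R :> R].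
Proof.
move=> q0; exists `|numq q|%N, `|denq q|%N; split.
- by rewrite absz_gt0 numq_eq0 gt_eqF.
- by rewrite absz_gt0 denq_eq0.
- rewrite /ratr -[in LHS](gez0_abs (denq_ge0 q)).
  by rewrite -[in LHS](@gez0_abs (numq q)) // numq_ge0 ltW.
Qed.

(** * From strict monotonicity to arbitrary weights *)

(** No vector [(p i, q i)] lies in the quadrant [p <= 0 <= q], and no two of
    them have a nontrivial nonnegative combination in it.  Let [rho] be the slope
    of the steepest vector with [p j > 0], or [0] if there is none of positive
    slope.  Every vector lies on or below the line of slope [rho] through the
    origin, and strictly below when [p i <= 0].  Nonnegative combinations inherit
    the bound, and [rho >= 0] keeps that line out of the interior of the
    quadrant. *)
Lemma sum_lt0_of_slopes (R : realType) (n : nat) (l p q : 'I_n -> R) :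
  (forall i, 0 <= l i) -> (exists i, l i != 0) ->
  (forall i, p i <= 0 -> q i < 0) ->
  (forall i j, p i < 0 -> 0 < p j -> 0 < q j -> q j / p j < q i / p i) ->
  \sum_i l i * p i <= 0 -> \sum_i l i * q i < 0.
Proof.
move=> l0 [i0 li0] pq slopes P0.
pose rho := \big[Order.max/0]_(j < n | 0 < p j) (q j / p j).
have rho0 : 0 <= rho by exact: bigmax_ge_id.
have strict i : p i <= 0 -> q i < rho * p i.
  rewrite le_eqVlt => /predU1P[pi0|pi0]; first by rewrite pi0 mulr0 pq ?pi0.
  have qi0 := pq i (ltW pi0).
  have si0 : 0 < q i / p i by rewrite -mulrNN -invrN divr_gt0 ?oppr_gt0.
  rewrite -ltr_ndivlMr //; apply: bigmax_lt => // j pj0.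
  have [qj0|qj0] := ltP 0 (q j); first exact: slopes.
  by apply: le_lt_trans si0; rewrite pmulr_lle0 ?invr_gt0.
have weak i : q i <= rho * p i.
  have [pi0|/strict/ltW//] := ltP 0 (p i).
  by rewrite -ler_pdivrMr //; apply: le_bigmax_cond.
(* A combination with [\sum_i l i * p i <= 0] must involve a vector with
   [p i <= 0], and that one makes the inequality strict. *)
suff : \sum_i l i * q i < rho * \sum_i l i * p i.
  by move=> /lt_le_trans; apply; rewrite mulr_ge0_le0.
have [i lpi] : exists i, l i != 0 /\ p i <= 0.
  apply: contrapT => noi.
  have pos i : l i != 0 -> 0 < p i.
    by move=> li; rewrite ltNge; apply/negP => pi; apply: noi; exists i.
  suff : 0 < \sum_i l i * p i by rewrite ltNge P0.
  rewrite (bigD1 i0) //= ltr_pwDl ?mulr_gt0 ?pos ?lt0r ?li0 ?l0 //.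
  rewrite sumr_ge0 // => i _; have [->|li] := eqVneq (l i) 0.
    by rewrite mul0r.
  by rewrite mulr_ge0 // ltW // pos.
have [li pi] := lpi.
rewrite mulr_sumr (bigD1 i) //= [ltRHS](bigD1 i) //= ltr_leD //.
- by rewrite mulrCA ltr_pM2l ?strict // lt0r li l0.
- by apply: ler_sum => j _; rewrite mulrCA ler_wpM2l.
Qed.

(** If [psi (x i) s < 0] and [psi (x j) t > 0], then [s] and [t] both lie
    between the sign changes of [psi (x i)] and [psi (x j)], where the growth of
    the quotient from [s] to [t] is, after cross-multiplication, the comparison
    of the slopes [psi (x j) t / psi (x j) s] and [psi (x i) t / psi (x i) s].
    That [psi (x i)] vanishes at its sign change is what puts [s] strictly
    to the right of it. *)
Lemma weighted_sum_crosses_down (R : realType) (X : Type) (Theta : set R)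
    (psi : X -> R -> R) (n : nat) (l : n.-tuple R) (x : n.-tuple X) :
  Psi_T Theta 1 psi -> (forall z, psi z (vartheta1 Theta psi z) = 0) ->
  (forall z y, vartheta1 Theta psi z < vartheta1 Theta psi y ->
     strictly_increasing_on (quot_dom Theta psi z y) (quot psi z y)) ->
  Lambda l -> crosses_down Theta (weighted_sum psi l x).
Proof.
move=> T1 Z1 Rinc [l0 ln0] s t Ts Tt st; apply: sum_lt0_of_slopes => //.
  by move=> i; apply: (sign_change_crosses_down (vartheta1P T1 _) (Z1 _)).
move=> i j pi0 pj0 qj0.
set z := tnth x i in pi0 *; set y := tnth x j in pj0 qj0 *.
have [_ zpos _] := vartheta1P T1 z; have [_ _ yneg] := vartheta1P T1 y.
have zs : vartheta1 Theta psi z < s.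
  rewrite lt_neqAle; apply/andP; split.
    by apply/eqP => zs; move: pi0; rewrite -zs Z1 ltxx.
  by rewrite leNgt; apply/negP => /(zpos s Ts); rewrite ltNge (ltW pi0).
have ty : t < vartheta1 Theta psi y.
  rewrite lt_neqAle; apply/andP; split.
    by apply/eqP => ty; move: qj0; rewrite ty Z1 ltxx.
  by rewrite leNgt; apply/negP => /(yneg t Tt); rewrite ltNge (ltW qj0).
have zy := lt_trans zs (lt_trans st ty).
have := Rinc z y zy s t.
rewrite /quot_dom /= zs ty (lt_trans st ty) (lt_trans zs st).
move=> /(_ isT isT st); rewrite /quot -!mulNr.
rewrite ltr_pdivlMr // mulrAC ltr_pdivrMr // => cross.
rewrite ltr_ndivlMr // mulrAC ltr_pdivlMr //; lra.
Qed.

(** Positivity of [psi (x i)] extends to the left, so all terms are positive at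
    the leftmost of the points chosen for the individual terms; the rightmost
    point serves for negativity. *)
Lemma weighted_sum_takes_signs (R : realType) (X : Type) (Theta : set R)
    (psi : X -> R -> R) (n : nat) (l : n.-tuple R) (x : n.-tuple X) :
  Psi Theta psi -> (forall z, crosses_down Theta (psi z)) -> Lambda l ->
  (exists2 p, Theta p & 0 < weighted_sum psi l x p) /\
  (exists2 m, Theta m & weighted_sum psi l x m < 0).
Proof.
move=> Ppsi cd [l0 [i0 li0]].
have sum_gt0 (g : 'I_n -> R) :
    (forall i, 0 < g i) -> 0 < \sum_i tnth l i * g i.
  move=> g0; have lpos : 0 < tnth l i0 by rewrite lt0r li0 l0.
  rewrite (bigD1 i0) //= ltr_pwDl ?mulr_gt0 //.
  by rewrite sumr_ge0 // => i _; rewrite mulr_ge0 // ltW.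
have /choice[tp tpP] : forall i, exists tp, Theta tp /\ 0 < psi (tnth x i) tp.
  by move=> i; have [tp [tm [? _ _ ? _]]] := Ppsi (tnth x i); exists tp.
have /choice[tm tmP] : forall i, exists tm, Theta tm /\ psi (tnth x i) tm < 0.
  by move=> i; have [_ [tm [_ ? _ _ ?]]] := Ppsi (tnth x i); exists tm.
split.
- have [i _ imin] := arg_minP tp (isT : xpredT i0).
  exists (tp i); first by case: (tpP i).
  apply: sum_gt0 => j.
  have [Tj pj] := tpP j; have [Ti _] := tpP i.
  exact: (crosses_down_gt0 (cd _) Ti Tj (imin j isT) pj).
- have [i _ imax] := arg_maxP tm (isT : xpredT i0).
  exists (tm i); first by case: (tmP i).
  rewrite -oppr_gt0 /weighted_sum -sumrN.
  under eq_bigr do rewrite -mulrN.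
  apply: sum_gt0 => j; rewrite oppr_gt0.
  have [Tj pj] := tmP j; have [Ti _] := tmP i.
  exact: (crosses_down_lt0 (cd _) Tj Ti (imax j isT) pj).
Qed.

(** * Levels of increase and points of sign change *)

Theorem theorem2p12 (R : realType) (X : Type) (X_nonempty : [set: X] !=set0)
    (Theta : set R) (Theta_nonempty : Theta !=set0) (Theta_open : open Theta)
    (Theta_interval : is_interval Theta)
    (psi : X -> R -> R) (psi_T1 : Psi_T Theta 1 psi) :
  (* (i) *)
  (forall l1 l2 : R, 0 < l1 -> 0 < l2 -> Psi_Tw Theta [tuple l1; l2] psi ->
     forall x y : X, vartheta1 Theta psi x < vartheta1 Theta psi y ->
       level_of_increase (quot_dom Theta psi x y) (quot psi x y) (l1 / l2) /\
       level_of_increase (quot_dom Theta psi x y) (quot psi x y) (l2 / l1))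
  /\
  (* (ii) *)
  (forall (n : nat) (l : n.-tuple R), (1 < n)%N ->
     (forall i, 0 < tnth l i) -> Psi_Tw Theta l psi ->
     forall x y : X, vartheta1 Theta psi x < vartheta1 Theta psi y ->
     forall k : nat, (1 <= k <= n.-1)%N ->
       level_of_increase (quot_dom Theta psi x y) (quot psi x y)
         ((\sum_(i < n | (i < k)%N) tnth l i) /
          (\sum_(i < n | (k <= i)%N) tnth l i)) /\
       level_of_increase (quot_dom Theta psi x y) (quot psi x y)
         ((\sum_(i < n | (k <= i)%N) tnth l i) /
          (\sum_(i < n | (i < k)%N) tnth l i)))
  /\
  (* (iii) *)
  (forall n : nat, (1 < n)%N -> Psi_T Theta n psi ->
     forall x y : X, vartheta1 Theta psi x < vartheta1 Theta psi y ->
     forall k : nat, (1 <= k <= n.-1)%N ->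
       level_of_increase (quot_dom Theta psi x y) (quot psi x y)
         (k%:R / (n - k)%:R))
  /\
  (* (iv) *)
  ((infinite_set [set n : nat | (0 < n)%N /\ Psi_T Theta n psi] ->
      forall x y : X, vartheta1 Theta psi x < vartheta1 Theta psi y ->
        increasing_on (quot_dom Theta psi x y) (quot psi x y))
   /\
   ((forall m : nat, (0 < m)%N ->
       exists n : nat, [/\ (0 < n)%N, (m %| n)%N & Psi_T Theta n psi]) ->
      forall x y : X, vartheta1 Theta psi x < vartheta1 Theta psi y ->
      forall q : rat, 0 < q ->
        level_of_increase (quot_dom Theta psi x y) (quot psi x y) (ratr q)))
  /\
  (* (v) *)
  ((forall l : 2.-tuple R, Lambda l -> Psi_Tw Theta l psi) ->
     forall x y : X, vartheta1 Theta psi x < vartheta1 Theta psi y ->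
       strictly_increasing_on (quot_dom Theta psi x y) (quot psi x y))
  /\
  (* (vi) *)
  (Psi_Z Theta 1 psi ->
     (forall x y : X, vartheta1 Theta psi x < vartheta1 Theta psi y ->
        strictly_increasing_on (quot_dom Theta psi x y) (quot psi x y)) ->
     forall (n : nat) (l : n.-tuple R), (0 < n)%N -> Lambda l ->
       Psi_Tw Theta l psi).
Proof.
split=> [l1 l2 l10 l20 T2 x y _|].
  have [lev12 lev21] := pair_levels x y Theta_interval psi_T1 T2.
  by split; [apply: lev12|apply: lev21].
split=> [n l n1 l0 Tl x y _ k kn|].
  by apply: blocks_levels => //; case: n n1 {l l0 Tl} kn.
split=> [n n1 Tn x y _ k kn|].
  by apply: equal_weights_levels => //; case: n n1 {Tn} kn.
split; [split|split].
- move=> Tinf x y _; apply: increasing_of_dense_levels.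
    by move=> t; apply: quot_gt0.
  move=> a b a0 ab; have [N oddsN] := odds_between a0 ab.
  have [n [[_ Tn] /negP]] :=
    infinite_setN0 (infinite_setD Tinf (finite_II N.+1)).
  rewrite -leqNgt => Nn.
  have [k kn hk] := oddsN n Nn.
  by exists (k%:R / (n - k)%:R) => //; apply: equal_weights_levels.
- move=> Tdiv x y _ q q0; have [a [b [a0 b0 ->]]] := ratr_pos_frac R q0.
  (* With [n = j * (a + b)] the block size [k = j * a] gives
     [k / (n - k) = a / b]. *)
  have [n [n0 /dvdnP[j nE] Tn]] := Tdiv (a + b)%N (ltn_addr b a0).
  have j0 : (0 < j)%N by move: n0; rewrite nE muln_gt0 => /andP[].
  have -> : a%:R / b%:R = (j * a)%:R / (n - j * a)%:R :> R.
    rewrite nE mulnDr addKn !natrM -mulf_div divff ?mul1r //.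
    by rewrite pnatr_eq0 -lt0n.
  apply: equal_weights_levels => //.
  by rewrite muln_gt0 j0 a0 nE mulnDr -[ltnLHS]addn0 ltn_add2l muln_gt0 j0.
- move=> T2 x y _; apply: strictly_increasing_of_levels.
    by move=> t; apply: quot_gt0.
  move=> c c0; rewrite -[c]divr1.
  suff /T2 T1c : Lambda [tuple 1; c].
    by have [_] := pair_levels x y Theta_interval psi_T1 T1c; apply.
  split=> [i|]; last by exists ord0; rewrite oner_neq0.
  by rewrite (tnth_nth 0); case: i => [[|[|//]]] /= _; rewrite ?ler01 ?ltW.
- move=> [_ Z1] Rinc n l n0 Ll; split=> [|x]; first by case: psi_T1.
  have {}Z1 z : psi z (vartheta1 Theta psi z) = 0.
    by have := Z1 [tuple z]; rewrite big_ord1.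
  have cd z : crosses_down Theta (psi z).
    exact: sign_change_crosses_down (vartheta1P psi_T1 z) (Z1 z).
  have [[p Tp pos] [m Tm neg]] :=
    weighted_sum_takes_signs x (proj1 psi_T1) cd Ll.
  apply: (@crosses_down_sign_change _ _ _ p m) => //.
  exact: weighted_sum_crosses_down.
Qed.
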